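(* For every non-exceptional species of isonemal fabrics there exist fabrics of that species that can be perfectly coloured by assigning different colours to all single strands (thin striping with all colours distinct); and for every non-exceptional species other than those whose fabrics are of genus I or II, there exist fabrics of that species that can be perfectly coloured by assigning different colours to all adjacent pairs of strands (thick striping with all colours distinct).
   Context: Cells are unit squares $[i,i+1]\times[j,j+1]$ tessellating the plane; vertical strips of cells are warps, horizontal strips (rows) are wefts. A prefabric assigns to each cell which crossing strand is on top; a fabric is one that does not fall apart. With $\tau$ reflection in the plane of the fabric (reversing over/under everywhere), the symmetry group $G_1$ consists of pairs $(t,r)$, $t$ a plane isometry preserving the cell tessellation, $r\in\{e,\tau\}$, such that $t$ maps the over/under relation to itself ($r=e$, side-preserving) or to its reverse ($r=\tau$); $H_1$ is the subgroup of side-preserving elements. Isonemal: periodic with $G_1$ transitive on all strands. Order: the period of the design along a strand; non-exceptional: order greater than four. Species: Roth classified the symmetry groups of non-exceptional isonemal prefabrics into 39 types, each given by the pair (crystallographic type of $G_1$, crystallographic type of $H_1$) and numbered 1–39 (1–10 having only parallel symmetry axes, 11–32 perpendicular axes, 33–39 no axes but quarter-turns); the species of a prefabric is its Roth type, refined into disjoint subspecies (e.g. $1_m,1_o,1_e,\dots,36_s,37,38,39$) by Thomas. Genus I: $G_1$ contains a side-preserving translation mapping each row to the adjacent row; genus II: such a translation combined with $\tau$. Thin striping gives each strand a colour; thick striping gives each pair of strands $[2a,2a+2]$ (warps) and $[2b,2b+2]$ (wefts) a colour. An element $(t,r)$ of $G_1$ is a colour symmetry if for each colour $t$ maps all strands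 of that colour onto strands of one common colour; a colouring is perfect if all of $G_1$ consists of colour symmetries. *)

(* Defs.v *)
From Stdlib Require List.
From mathcomp Require Import all_boot all_order all_algebra.

Set Implicit Arguments.
Unset Strict Implicit.
Unset Printing Implicit Defensive.

Import Order.TTheory GRing.Theory Num.Theory.
Local Open Scope ring_scope.

(** * Isometries of the plane that preserve the tessellation by unit cells *)

(* (s, e1, e2) is (x, y) |-> (+-x, +-y) if s = false, (+-y, +-x) if s = true;
   e1 and e2 say whether the first and second output coordinates are negated. *)
Definition d4 : Type := (bool * bool * bool)%type.

Definition sgn (V : zmodType) (e : bool) (x : V) : V := if e then - x else x.

Definition lin (V : zmodType) (u : d4) (z : V * V) : V * V :=
  let: (s, e1, e2) := u in
  let: (x, y) := if s then (z.2, z.1) else z in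
  (sgn e1 x, sgn e2 y).

Record isom : Type := Isom { lpart : d4; tpart : int * int }.

Definition translation (a b : int) : isom := Isom (false, false, false) (a, b).

(* Every map considered below has a rational matrix, so rational points
   suffice. *)
Definition pt : Type := (rat * rat)%type.

Definition isom_pt (t : isom) (z : pt) : pt :=
  lin (lpart t) z + ((tpart t).1%:~R, (tpart t).2%:~R).

(** * Strands and prefabrics *)

(* Warp i is the vertical strip [i, i + 1] x R, Weft j is R x [j, j + 1]. *)
Inductive strand : Type := Warp of int | Weft of int.

Definition strip (s : strand) (z : pt) : bool :=
  match s with
  | Warp i => i%:~R <= z.1 <= i%:~R + 1
  | Weft j => j%:~R <= z.2 <= j%:~R + 1
  end.

(* x |-> - x maps [i, i + 1] to [- i - 1, - i]. *)
Definition flip (e : bool) (i : int) : int := if e then - i - 1 else i.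

Definition isom_strand (t : isom) (s : strand) : strand :=
  let: (w, e1, e2) := lpart t in
  let: (a, b) := tpart t in
  match s, w with
  | Warp i, false => Warp (flip e1 i + a)
  | Weft j, false => Weft (flip e2 j + b)
  | Warp i, true => Weft (flip e2 i + b)
  | Weft j, true => Warp (flip e1 j + a)
  end.

Lemma strip_isom (t : isom) (s : strand) (z : pt) :
  strip (isom_strand t s) (isom_pt t z) = strip s z.
Proof.
have H (e : bool) (i a : int) (x : rat) :
    ((flip e i + a)%:~R <= sgn e x + a%:~R <= (flip e i + a)%:~R + 1)
    = (i%:~R <= x <= i%:~R + 1).
  rewrite intrD addrAC !lerD2r /flip /sgn; case: e => //.
  by rewrite intrB intrN subrK lerN2 -opprD lerN2 andbC.
case: t => [[[w e1] e2] [a b]]; case: z => x y.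
by case: w; case: s => i; rewrite /strip /isom_strand /isom_pt /= H.
Qed.

(* F i j is true when, on the cell [i, i + 1] x [j, j + 1], the warp is on
   top. *)
Definition prefabric : Type := int -> int -> bool.

Definition crossing (s s' : strand) : bool :=
  match s, s' with
  | Warp _, Weft _ | Weft _, Warp _ => true
  | _, _ => false
  end.

Definition over (F : prefabric) (s s' : strand) : bool :=
  match s, s' with
  | Warp i, Weft j => F i j
  | Weft j, Warp i => ~~ F i j
  | _, _ => false
  end.

Definition falls_apart (F : prefabric) : Prop :=
  exists A : strand -> Prop,
    [/\ exists s, A s, exists s, ~ A s
      & forall s s', A s -> ~ A s' -> crossing s s' -> over F s s'].

(** * Symmetry *)

(* G1 F t r : the pair (t, r) is a symmetry of F; r = true stands for tau and
   r = false for e. *)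
Definition G1 (F : prefabric) (t : isom) (r : bool) : Prop :=
  forall s s' : strand,
    over F s s' =
    if r then over F (isom_strand t s') (isom_strand t s)
    else over F (isom_strand t s) (isom_strand t s').

(* Since (id, tau) is never a symmetry, G1 projects isomorphically onto this
   group of plane isometries. *)
Definition G1_plane (F : prefabric) (t : isom) : Prop := exists r, G1 F t r.

Definition H1 (F : prefabric) (t : isom) : Prop := G1 F t false.

Definition periodic (F : prefabric) : Prop :=
  exists a b c d : int,
    [/\ a * d - b * c != 0, G1_plane F (translation a b)
      & G1_plane F (translation c d)].

Definition isonemal (F : prefabric) : Prop :=
  periodic F /\
  forall s s' : strand, exists t, G1_plane F t /\ isom_strand t s = s'.

Definition along (F : prefabric) (s : strand) (k : int) : bool :=
  match s with Warp i => F i k | Weft j => F k j end.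

Definition strand_period (F : prefabric) (s : strand) (n : nat) : Prop :=
  (0 < n)%N /\ forall k : int, along F s (k + n%:Z) = along F s k.

Definition order (F : prefabric) (n : nat) : Prop :=
  forall s : strand,
    strand_period F s n /\ forall m, strand_period F s m -> (n <= m)%N.

Definition nonexceptional (F : prefabric) : Prop :=
  exists n, order F n /\ (4 < n)%N.

Definition genus_I (F : prefabric) : Prop :=
  exists a : int, G1 F (translation a 1) false.

Definition genus_II (F : prefabric) : Prop :=
  exists a : int, G1 F (translation a 1) true.

(** * Crystallographic types *)

(* Only the types that occur among the groups G1 and H1 of non-exceptional
   isonemal prefabrics. *)
Inductive wallpaper : Type :=
  p1 | p2 | pm | pg | cm | pmm | pmg | pgg | cmm | p4.

(* The general positions of the International Tables, with respect to the
   conventional cell; the group consists of the listed maps followed by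
   integral translations. *)
Definition general_positions (w : wallpaper) : seq (d4 * pt) :=
  let id_ := (false, false, false) in
  let half_turn := (false, true, true) in
  let minus_x := (false, true, false) in
  let minus_y := (false, false, true) in
  let turn := (true, true, false) in
  let turn' := (true, false, true) in
  let o : pt := (0, 0) in
  let h : rat := 2^-1 in
  match w with
  | p1 => [:: (id_, o)]
  | p2 => [:: (id_, o); (half_turn, o)]
  | pm => [:: (id_, o); (minus_x, o)]
  | pg => [:: (id_, o); (minus_x, (0, h))]
  | cm => [:: (id_, o); (minus_x, o); (id_, (h, h)); (minus_x, (h, h))]
  | pmm => [:: (id_, o); (half_turn, o); (minus_x, o); (minus_y, o)]
  | pmg => [:: (id_, o); (half_turn, o); (minus_x, (h, 0)); (minus_y, (h, 0))]
  | pgg => [:: (id_, o); (half_turn, o); (minus_x, (h, h)); (minus_y, (h, h))]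
  | cmm => [:: (id_, o); (half_turn, o); (minus_x, o); (minus_y, o);
               (id_, (h, h)); (half_turn, (h, h));
               (minus_x, (h, h)); (minus_y, (h, h))]
  | p4 => [:: (id_, o); (half_turn, o); (turn, o); (turn', o)]
  end.

Definition standard_group (w : wallpaper) (g : pt -> pt) : Prop :=
  exists2 q : d4 * pt, q \in general_positions w
    & exists m n : int,
        forall z, g z = lin q.1 z + q.2 + (m%:~R, n%:~R).

Record affine : Type :=
  Affine { m11 : rat; m12 : rat; m21 : rat; m22 : rat; v1 : rat; v2 : rat }.

Definition affine_pt (f : affine) (z : pt) : pt :=
  (m11 f * z.1 + m12 f * z.2 + v1 f, m21 f * z.1 + m22 f * z.2 + v2 f).

Definition invertible (f : affine) : Prop :=
  m11 f * m22 f - m12 f * m21 f != 0.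

Definition conjugates (f : affine) (t : isom) (g : pt -> pt) : Prop :=
  forall z, affine_pt f (isom_pt t z) = g (affine_pt f z).

Definition crystallographic_type (G : isom -> Prop) (w : wallpaper) : Prop :=
  exists f : affine,
    [/\ invertible f,
        forall t, G t -> exists2 g, standard_group w g & conjugates f t g
      & forall g, standard_group w g -> exists2 t, G t & conjugates f t g].

(** * Species *)

(* The translations in G move the rows by exactly the multiples of d (the
   horizontal components of these translations being arbitrary). *)
Definition row_step (G : isom -> Prop) (d : nat) : Prop :=
  [/\ (0 < d)%N, exists a : int, G (translation a d%:Z)
    & forall a k : int, G (translation a k) -> (d %| k)%Z].

(* A Roth type G1/H1; H1_type = None is the dash of the usual notation, that
   is, H1 = G1.  Several of the 39 types share the symbol G1/H1; they are told
   apart by how far translations move the rows: G1_step = 1 means genus I or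
   II, and then H1_step = 1 means that genus I occurs. *)
Record roth_type : Type := Roth {
  G1_type : wallpaper;
  H1_type : option wallpaper;
  G1_step : nat;
  H1_step : nat
}.

Definition has_roth_type (F : prefabric) (s : roth_type) : Prop :=
  [/\ crystallographic_type (G1_plane F) (G1_type s),
      match H1_type s with
      | None => forall t r, G1 F t r -> r = false
      | Some w => crystallographic_type (H1 F) w /\ exists t, G1 F t true
      end,
      row_step (G1_plane F) (G1_step s)
    & row_step (H1 F) (H1_step s)].

(* Grouped as in Roth's classification, but not in his order inside each
   group. *)
Definition roth_types : list roth_type := [::
  (* 10 types with parallel axes only *)
  Roth pg None 1 1;
  Roth pg (Some p1) 1 1;
  Roth pg (Some pg) 1 1; Roth pg (Some pg) 1 2;
  Roth pm (Some p1) 1 1;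
  Roth pm (Some pg) 1 1; Roth pm (Some pg) 1 2;
  Roth cm (Some p1) 1 1;
  Roth cm (Some pg) 1 1; Roth cm (Some pg) 1 2;
  (* 22 types with perpendicular axes *)
  Roth pgg None 1 1; Roth pgg None 2 2;
  Roth pgg (Some pg) 1 1; Roth pgg (Some pg) 2 2;
  Roth pgg (Some p2) 1 1; Roth pgg (Some p2) 2 2;
  Roth pmg (Some pg) 1 1; Roth pmg (Some pg) 2 2;
  Roth pmg (Some p2) 1 1; Roth pmg (Some p2) 2 2;
  Roth pmg (Some pgg) 1 1; Roth pmg (Some pgg) 1 2;
  Roth pmg (Some pgg) 2 2; Roth pmg (Some pgg) 2 4;
  Roth pmm (Some p2) 1 1; Roth pmm (Some p2) 2 2;
  Roth cmm (Some p2) 1 1; Roth cmm (Some p2) 2 2;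
  Roth cmm (Some pgg) 1 1; Roth cmm (Some pgg) 1 2;
  Roth cmm (Some pgg) 2 2; Roth cmm (Some pgg) 2 4;
  (* 7 types with quarter-turns and no axes *)
  Roth p4 None 1 1; Roth p4 None 2 2;
  Roth p4 (Some p2) 1 1; Roth p4 (Some p2) 2 2;
  Roth p4 (Some p4) 1 1; Roth p4 (Some p4) 2 2; Roth p4 (Some p4) 2 4]%N.

Lemma size_roth_types : size roth_types = 39%N.
Proof. by []. Qed.

Definition roth_class (s : roth_type) (F : prefabric) : Prop :=
  [/\ isonemal F, nonexceptional F, ~ falls_apart F & has_roth_type F s].

(* u carries the symmetry group of F to that of F' *)
Definition same_symmetry_group (u : isom) (F F' : prefabric) : Prop :=
  forall t t' : isom,
    (forall z, isom_pt u (isom_pt t z) = isom_pt t' (isom_pt u z)) ->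
    forall r, G1 F t r <-> G1 F' t' r.

(* A species is one of the 39 Roth classes of fabrics.  The classes are also
   subdivided, according to the position of the symmetry group relative to the
   cells (parity of dimensions, centres at corners or inside cells, ...);
   the second constructor admits every inhabited part of such a subdivision. *)
Inductive species : (prefabric -> Prop) -> Prop :=
| roth_species (s : roth_type) :
    List.In s roth_types -> species (roth_class s)
| roth_subspecies (s : roth_type) (K : prefabric -> Prop) :
    List.In s roth_types ->
    (forall F, K F -> roth_class s F) ->
    (exists F, K F) ->
    (forall u F F', K F -> roth_class s F' -> same_symmetry_group u F F' ->
       K F') ->
    species K.

(** * Colouring by striping *)

Definition colour_symmetry (C : Type) (c : strand -> C) (t : isom) : Prop :=
  forall k : C, exists k' : C,
    forall s, c s = k -> c (isom_strand t s) = k'.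

Definition perfect (F : prefabric) (C : Type) (c : strand -> C) : Prop :=
  forall t r, G1 F t r -> colour_symmetry c t.

(* Warps (wefts) 2a and 2a + 1 form the pair [2a, 2a + 2]. *)
Definition pair_of (s : strand) : strand :=
  match s with
  | Warp i => Warp (i %/ 2)%Z
  | Weft j => Weft (j %/ 2)%Z
  end.

Definition thin_all_distinct (C : Type) (c : strand -> C) : Prop :=
  forall s s', c s = c s' <-> s = s'.

Definition thick_all_distinct (C : Type) (c : strand -> C) : Prop :=
  forall s s', c s = c s' <-> pair_of s = pair_of s'.

(* Main.v *)
(* The colouring with all strands distinct is perfect for every prefabric, so
   the first claim says that every Roth class is inhabited.  For each of the 39
   classes a fabric is given by its values on an n x n square, n being the
   order; its symmetries are computed modulo n and matched with the general
   positions of the required wallpaper groups in an explicit unit cell.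

   The colouring by pairs is perfect exactly when all symmetries have an even
   translation part.  Without genus I or II all translations are even.  The
   point group is abelian and exchanges warps and wefts, so the symmetries that
   do not exchange them are translations and half-turns; transitivity on the
   warps and on the wefts makes the half-turns even.  The remaining symmetries
   then have translation parts congruent to a fixed (c, c) modulo 2, and a
   translation of the fabric by (c, 0) makes them even as well. *)

From Stdlib Require Import BinNat.
From mathcomp Require Import all_boot all_order all_algebra.
From mathcomp Require Import zify ring.
Require Import Defs.

Set Implicit Arguments.
Unset Strict Implicit.
Unset Printing Implicit Defensive.

Import Order.TTheory GRing.Theory Num.Theory.
Local Open Scope ring_scope.

(** * The group of isometries *)

Definition d4_mul (u u' : d4) : d4 :=
  let: (s, e1, e2) := u in
  let: (s', e1', e2') := u' in
  (s (+) s', e1 (+) (if s then e2' else e1'), e2 (+) (if s then e1' else e2')).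

Definition d4_inv (u : d4) : d4 :=
  let: (s, e1, e2) := u in if s then (s, e2, e1) else u.

Definition isom_mul (t t' : isom) : isom :=
  Isom (d4_mul (lpart t) (lpart t')) (lin (lpart t) (tpart t') + tpart t).

Definition isom_inv (t : isom) : isom :=
  Isom (d4_inv (lpart t)) (- lin (d4_inv (lpart t)) (tpart t)).

Definition isom_conj (u t : isom) : isom :=
  isom_mul (isom_mul u t) (isom_inv u).

Lemma sgn_addb (V : zmodType) (e e' : bool) (x : V) :
  sgn (e (+) e') x = sgn e (sgn e' x).
Proof. by case: e e' => [] [] //=; rewrite opprK. Qed.

Lemma sgnD (V : zmodType) (e : bool) : {morph @sgn V e : x y / x + y}.
Proof. by case: e => x y //=; rewrite opprD. Qed.

Lemma linD (V : zmodType) (u : d4) : {morph @lin V u : z z' / z + z'}.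
Proof.
by case: u => [[[] e1] e2] [x y] [x' y']; rewrite /lin /= !sgnD.
Qed.

Lemma lin_mul (V : zmodType) (u u' : d4) (z : V * V) :
  lin (d4_mul u u') z = lin u (lin u' z).
Proof.
by case: u u' z => [[[] e1] e2] [[[] e1'] e2'] [x y]; rewrite /lin /= !sgn_addb.
Qed.

Lemma lin_invK (V : zmodType) (u : d4) (z : V * V) :
  lin u (lin (d4_inv u) z) = z.
Proof.
by case: u z => [[[] []] []] [x y]; rewrite /lin /= ?opprK.
Qed.

Lemma d4_invK : involutive d4_inv.
Proof. by case=> [[[] []] []]. Qed.

Lemma lin0 (V : zmodType) (u : d4) : lin u 0 = 0 :> V * V.
Proof. by apply: (@addIr _ (lin u 0)); rewrite -linD !add0r. Qed.

Lemma linN (V : zmodType) (u : d4) : {morph @lin V u : z / - z}.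
Proof.
by move=> z; apply/eqP; rewrite -addr_eq0 -linD addNr lin0.
Qed.

Definition to_pt (v : int * int) : pt := (v.1%:~R, v.2%:~R).

Lemma to_ptD : {morph to_pt : v w / v + w}.
Proof. by case=> a b [c d]; rewrite /to_pt /= !intrD. Qed.

Lemma to_pt_lin u v : to_pt (lin u v) = lin u (to_pt v).
Proof. by case: u v => [[[] []] []] [a b]; rewrite /to_pt /lin /= ?intrN. Qed.

Lemma isom_pt_mul t t' z : isom_pt (isom_mul t t') z = isom_pt t (isom_pt t' z).
Proof.
rewrite /isom_pt /isom_mul [tpart (Isom _ _)]/= [lpart (Isom _ _)]/=.
by rewrite lin_mul -!/(to_pt _) to_ptD to_pt_lin linD addrA.
Qed.

Lemma isom_strand_mul t t' s :
  isom_strand (isom_mul t t') s = isom_strand t (isom_strand t' s).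
Proof.
case: t t' => [[[w e1] e2] [a b]] [[[w' e1'] e2'] [a' b']].
by case: s w w' e1 e2 e1' e2' => i [] [] [] [] [] [];
  rewrite /isom_strand /isom_mul /= /flip; congr (_ _); lia.
Qed.

Lemma isom_invK t : cancel (isom_strand (isom_inv t)) (isom_strand t).
Proof.
case: t => [[[w e1] e2] [a b]] s.
by case: s w e1 e2 => i [] [] [];
  rewrite /isom_strand /isom_inv /= /flip; congr (_ _); lia.
Qed.

Lemma isom_Kinv t : cancel (isom_strand t) (isom_strand (isom_inv t)).
Proof.
case: t => [[[w e1] e2] [a b]] s.
by case: s w e1 e2 => i [] [] [];
  rewrite /isom_strand /isom_inv /= /flip; congr (_ _); lia.
Qed.

Lemma isom_pt_invK t : cancel (isom_pt (isom_inv t)) (isom_pt t).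
Proof.
move=> z; rewrite /isom_pt /isom_inv [lpart (Isom _ _)]/= [tpart (Isom _ _)]/=.
rewrite -!/(to_pt _) linD lin_invK -to_pt_lin linN lin_invK -addrA -to_ptD.
by rewrite addNr addr0.
Qed.

Lemma isom_pt_Kinv t : cancel (isom_pt t) (isom_pt (isom_inv t)).
Proof.
move=> z; rewrite /isom_pt /isom_inv [lpart (Isom _ _)]/= [tpart (Isom _ _)]/=.
rewrite -!/(to_pt _) linD -to_pt_lin -addrA -to_ptD addrN.
by rewrite addr0 -{2}[lpart t]d4_invK lin_invK.
Qed.

Lemma isom_conj_strand u t s :
  isom_strand (isom_conj u t) (isom_strand u s)
  = isom_strand u (isom_strand t s).
Proof. by rewrite !isom_strand_mul isom_Kinv. Qed.

Lemma isom_conj_pt u t z :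
  isom_pt (isom_conj u t) (isom_pt u z) = isom_pt u (isom_pt t z).
Proof. by rewrite !isom_pt_mul isom_pt_Kinv. Qed.

Lemma to_pt_inj : injective to_pt.
Proof. by case=> a b [c d] [/intr_inj -> /intr_inj ->]. Qed.

Lemma isom_pt_int t v : isom_pt t (to_pt v) = to_pt (lin (lpart t) v + tpart t).
Proof. by rewrite to_ptD to_pt_lin. Qed.

(** The eight signed permutations send [(1, 2)] to eight distinct vectors, so this one vector
    separates them. *)
Lemma d4_eq (u u' : d4) : @lin int u (1, 2) = @lin int u' (1, 2) -> u = u'.
Proof. by case: u u' => [[[] []] []] [[[] []] []]. Qed.

Lemma isom_pt_inj t t' : isom_pt t =1 isom_pt t' -> t = t'.
Proof.
case: t t' => [u v] [u' v'] H.
have Hint w : lin u w + v = lin u' w + v'.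
  by apply: to_pt_inj; have := H (to_pt w); rewrite !isom_pt_int.
have Ev : v = v'.
  have := Hint 0.
  by case: u u' {H Hint} => [[[] []] []] [[[] []] []]; rewrite /lin /= !add0r.
rewrite Ev; congr Isom; apply: d4_eq.
by have := Hint (1, 2); rewrite Ev => /addIr.
Qed.

(** * Composition and inversion of symmetries *)

Lemma G1_mul F t t' r r' :
  G1 F t r -> G1 F t' r' -> G1 F (isom_mul t t') (r (+) r').
Proof.
move=> Ht Ht' s s'; rewrite !isom_strand_mul Ht'.
by case: r r' Ht {Ht'} => [] [] Ht /=; rewrite -Ht.
Qed.

Lemma G1_inv F t r : G1 F t r -> G1 F (isom_inv t) r.
Proof.
move=> Ht s s'; have := Ht (isom_strand (isom_inv t) s).
move=> /(_ (isom_strand (isom_inv t) s')); rewrite !isom_invK => H.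
have := Ht (isom_strand (isom_inv t) s').
move=> /(_ (isom_strand (isom_inv t) s)); rewrite !isom_invK => H'.
by case: r {Ht} H H'.
Qed.

Lemma strand_perfect F : perfect F (@id strand).
Proof. by move=> t r _ k; exists (isom_strand t k) => s ->. Qed.

Lemma isonemal_swap F : isonemal F ->
  exists t, [/\ G1_plane F t & (lpart t).1.1 = true].
Proof.
case=> _ /(_ (Warp 0) (Weft 0)) [t [Ht E]]; exists t; split=> //.
by case: t E {Ht} => [[[[] e1] e2] [a b]].
Qed.

(** * Commutativity of point groups *)

(** Each listed type has a cyclic group or a Klein four-group as its point group: no mirror or glide
    occurs together with a quarter-turn. *)
Lemma general_positions_comm w : {in general_positions w &, forall q q',
  d4_mul q.1 q'.1 = d4_mul q'.1 q.1}.
Proof.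
have /allrelP H : allrel (fun q q' : d4 * pt =>
    d4_mul q.1 q'.1 == d4_mul q'.1 q.1) (general_positions w)
    (general_positions w) by case: w.
by move=> q q' hq hq'; apply/eqP/H.
Qed.

(** Affine conjugation preserves the commutation of linear parts. As [conjugates] only equates maps,
    the linear parts are recovered from differences of values. *)
Lemma point_group_comm G w t t' : crystallographic_type G w -> G t -> G t' ->
  d4_mul (lpart t) (lpart t') = d4_mul (lpart t') (lpart t).
Proof.
case=> f [inv_f H _] /H [g [q hq [m [n Eg]]] Cg].
move=> /H [g' [q' hq' [m' [n' Eg']]] Cg'].
have shape q1 q2 (y c1 c2 : pt) (m1 n1 m2 n2 : int) :
    lin q1 (lin q2 y + c1 + (m1%:~R, n1%:~R)) + c2 + (m2%:~R, n2%:~R) =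
    lin (d4_mul q1 q2) y +
    (lin q1 (c1 + (m1%:~R, n1%:~R)) + (c2 + (m2%:~R, n2%:~R))) :> pt.
  by rewrite !linD lin_mul !addrA.
pose d z := affine_pt f (isom_pt (isom_mul t t') z)
            - affine_pt f (isom_pt (isom_mul t' t) z).
have cancel (a k k' : pt) : (a + k) - (a + k') = k - k'.
  by rewrite opprD addrACA subrr add0r.
(* In standard coordinates the two products have the same linear part, so they differ by a constant
   translation. *)
have d_const z z' : d z = d z'.
  rewrite /d !isom_pt_mul !(Cg, Cg') !(Eg, Eg') !shape.
  by rewrite (general_positions_comm hq hq') !cancel.
apply: d4_eq; apply: to_pt_inj; rewrite !to_pt_lin.
(* Comparing the values at [(1, 2)] and at 0 removes all translation parts. What remains says that
   the matrix of [f] kills the difference of the two images of [(1, 2)]; Cramer's rule then makes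
   this difference vanish. *)
have /eqP := d_const (to_pt (1, 2)) 0.
rewrite /d /isom_pt -subr_eq0 /isom_mul.
rewrite [lpart (Isom _ _)]/= [lpart (Isom _ _)]/=.
move: (d4_mul _ _) (d4_mul _ _) (tpart _) (tpart _) => u u' [a b] [a' b'].
rewrite !lin0 !add0r; move: (lin u _) (lin u' _) => [x y] [x' y'].
rewrite /affine_pt /= => /eqP [/eqP E1 /eqP E2].
have D0 : m11 f * m22 f - m12 f * m21 f != 0 := inv_f.
have [/eqP Ex /eqP Ey] : x' - x == 0 /\ y' - y == 0.
  move/eqP: E1 => E1; move/eqP: E2 => E2.
  split; rewrite -(mulrI_eq0 _ (mulfI D0)); apply/eqP.
    transitivity (m22 f * 0 - m12 f * 0); last by rewrite !mulr0 subr0.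
    by rewrite -{1}E1 -E2; ring.
  transitivity (m11 f * 0 - m21 f * 0); last by rewrite !mulr0 subr0.
  by rewrite -{1}E2 -E1; ring.
by rewrite (subr0_eq Ex) (subr0_eq Ey).
Qed.

(** * Thick striping *)

Definition shift (p q : int) (F : prefabric) : prefabric :=
  fun i j => F (i - p) (j - q).

Lemma over_shift p q F s s' :
  let u := translation p q in
  over (shift p q F) (isom_strand u s) (isom_strand u s') = over F s s'.
Proof. by case: s s' => i [] j //=; rewrite /shift !addrK. Qed.

Lemma G1_shift p q F t r :
  G1 F t r <-> G1 (shift p q F) (isom_conj (translation p q) t) r.
Proof.
split=> H s s'.
  rewrite -[s](isom_invK (translation p q)) -[s'](isom_invK (translation p q)).
  by rewrite !isom_conj_strand !over_shift H.
have := H (isom_strand (translation p q) s) (isom_strand (translation p q) s').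
by rewrite !isom_conj_strand !over_shift.
Qed.

Lemma isom_conjK u t : isom_conj u (isom_conj (isom_inv u) t) = t.
Proof.
apply: isom_pt_inj => z; rewrite -{1}[z](isom_pt_invK u).
by rewrite !isom_conj_pt isom_pt_invK.
Qed.

Lemma isom_conj_translation p q a b :
  isom_conj (translation p q) (translation a b) = translation a b.
Proof.
rewrite /isom_conj /isom_mul /isom_inv /translation /=.
by congr Isom; congr (_, _) => /=; lia.
Qed.

Lemma same_symmetry_group_shift p q F :
  same_symmetry_group (translation p q) F (shift p q F).
Proof.
move=> t t' H r; rewrite (G1_shift p q).
suff -> : isom_conj (translation p q) t = t' by [].
apply: isom_pt_inj => z.
by rewrite -[z](isom_pt_invK (translation p q)) isom_conj_pt H.
Qed.

Lemma crystallographic_type_shift p q (G G' : isom -> Prop) w :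
  (forall t, G t <-> G' (isom_conj (translation p q) t)) ->
  crystallographic_type G w -> crystallographic_type G' w.
Proof.
move=> HG [f [inv_f H H']]; set u := translation p q in HG.
(* The offsets make [f'] equal to [f] composed with the inverse of [u]. *)
pose f' := Affine (m11 f) (m12 f) (m21 f) (m22 f)
  (v1 f - m11 f * p%:~R - m12 f * q%:~R) (v2 f - m21 f * p%:~R - m22 f * q%:~R).
have Ef z : affine_pt f' (isom_pt u z) = affine_pt f z.
  by case: z => x y; rewrite /affine_pt /isom_pt /=; congr (_, _); ring.
have conj_f' t g : conjugates f t g -> conjugates f' (isom_conj u t) g.
  move=> Hg z; rewrite -[z](isom_pt_invK u) isom_conj_pt !Ef; exact: Hg.
exists f'; split=> [//|t|g].
  rewrite -[t](isom_conjK u) -HG => /H [g Hg Cg]; exists g => //.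
  exact: conj_f'.
move=> /H' [t Gt Cg]; exists (isom_conj u t); first exact/HG.
exact: conj_f'.
Qed.

(** Translations commute, so the conjugation fixes every translation of [G]. *)
Lemma row_step_shift p q (G G' : isom -> Prop) d :
  (forall t, G t <-> G' (isom_conj (translation p q) t)) ->
  row_step G d -> row_step G' d.
Proof.
move=> HG [d0 [a Ga] H].
have HT x y : G (translation x y) <-> G' (translation x y).
  by rewrite HG isom_conj_translation.
split=> //; first by exists a; apply/HT.
by move=> x k /HT /H.
Qed.

Lemma strand_period_shift p q F s n :
  strand_period (shift p q F) (isom_strand (translation p q) s) n
  <-> strand_period F s n.
Proof.
split=> -[n0 H]; split=> // k; case: s H => i /= H.
- by have := H (k + q); rewrite /shift !addrK addrAC addrK.
- by have := H (k + p); rewrite /shift !addrK addrAC addrK.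
- by rewrite /shift addrK addrAC H.
- by rewrite /shift addrK addrAC H.
Qed.

Lemma roth_class_shift p q s F : roth_class s F -> roth_class s (shift p q F).
Proof.
set u := translation p q.
have HG t : G1_plane F t <-> G1_plane (shift p q F) (isom_conj u t).
  by split=> -[r Hr]; exists r; move/(G1_shift p q F t r): Hr.
have HT x y :
    G1_plane F (translation x y) <-> G1_plane (shift p q F) (translation x y).
  by rewrite HG /u isom_conj_translation.
case=> -[[a [b [c [d [nz Hab Hcd]]]]] trans_F] [n [ord_F n4]] apart_F.
case=> G1F H1F step_G1 step_H1; split.
- split; first by exists a, b, c, d; split=> //; apply/HT.
  move=> x y; have [t [Ht E]] := trans_F (isom_strand (isom_inv u) x)
                                        (isom_strand (isom_inv u) y).
  exists (isom_conj u t); split; first exact/HG.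
  by rewrite -[x](isom_invK u) isom_conj_strand E isom_invK.
- exists n; split=> // x; rewrite -[x](isom_invK u).
  have [per_n min_n] := ord_F (isom_strand (isom_inv u) x).
  by split=> [|m]; rewrite strand_period_shift //; apply: min_n.
- case=> A [[x Ax] [y Ay] HA]; apply: apart_F.
  exists (fun z => A (isom_strand u z)); split.
  + by exists (isom_strand (isom_inv u) x); rewrite isom_invK.
  + by exists (isom_strand (isom_inv u) y); rewrite isom_invK.
  + move=> z z' Az Az' cr; rewrite -(over_shift p q); apply: HA => //.
    by case: z z' cr {Az Az'} => i [].
- split.
  + exact: crystallographic_type_shift HG G1F.
  + case: (H1_type s) H1F => [w [cH1 [t Ht]]|HN t r].
      split; last by exists (isom_conj u t); apply/(G1_shift p q F).
      by apply: crystallographic_type_shift cH1 => t'; apply: G1_shift.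
    by rewrite -[t](isom_conjK u) => /(G1_shift p q F)/HN.
  + exact: row_step_shift HG step_G1.
  + by apply: row_step_shift step_H1 => t'; apply: G1_shift.
Qed.

(** * Parity of the translation parts *)

Definition even_isom (t : isom) : Prop :=
  (2 %| (tpart t).1)%Z /\ (2 %| (tpart t).2)%Z.

(** The map [x |-> - x] takes [[2a, 2a + 2]] to [[- 2a - 2, - 2a]], again a pair, so only an odd
    translation part could break the pairing. *)
Lemma even_isom_thick F :
  (forall t, G1_plane F t -> even_isom t) -> perfect F pair_of.
Proof.
move=> HF t r Ht; have {HF Ht} [] := HF t (ex_intro _ r Ht).
case: t => [[[w e1] e2] [a b]] /= a2 b2 k.
(* The strand whose index is twice that of [k] represents the pair [k]; the witness is the pair of
   its image. *)
exists (pair_of (isom_strand (Isom (w, e1, e2) (a, b))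
  match k with Warp i => Warp (i * 2) | Weft j => Weft (j * 2) end)) => s.
by case: s => i <-; case: w => /=; congr (_ _); case: e1 e2 => [] [];
  rewrite /flip; lia.
Qed.

Lemma genus_free_even F s :
  roth_class s F -> G1_step s = 2%N -> exists p,
  forall t, G1_plane (shift p 0 F) t -> even_isom t.
Proof.
case=> isoF _ _ [G1F _ [_ _ row2] _] step2; rewrite {}step2 in row2.
have [t0 [G0 sw0]] := isonemal_swap isoF.
have mulG t t' : G1_plane F t -> G1_plane F t' -> G1_plane F (isom_mul t t').
  by move=> [r Hr] [r' Hr']; exists (r (+) r'); apply: G1_mul.
have invG t : G1_plane F t -> G1_plane F (isom_inv t).
  by move=> [r Hr]; exists r; apply: G1_inv.
case: t0 G0 sw0 => [[[w0 f1] f2] [a0 b0]] G0 /= sw0; subst w0.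
(* Conjugation by the exchanging element [t0] swaps the two signs, so commutation forces them to
   agree. *)
have half t e1 e2 : G1_plane F t -> lpart t = (false, e1, e2) -> e1 = e2.
  move=> Ht Et; have := point_group_comm G1F Ht G0.
  by rewrite Et /=; case: e1 e2 f1 f2 {G0 Et} => [] [] [] [].
have trans2 a b : G1_plane F (translation a b) -> even_isom (translation a b).
  move=> Gab; split; last exact: row2 Gab.
  (* [row2] controls vertical components only; conjugating by [t0] turns the horizontal component
     into a vertical one, up to sign. *)
  have := mulG _ _ (mulG _ _ G0 Gab) (invG _ G0).
  rewrite /isom_mul /isom_inv /=.
  by case: f1 f2 {G0} => [] [] /=; rewrite -/(translation _ _) => /row2 /=; lia.
have half_diff a b a' b' :
    G1_plane F (Isom (false, true, true) (a, b)) ->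
    G1_plane F (Isom (false, true, true) (a', b')) ->
    even_isom (translation (- a' + a) (- b' + b)).
  by move=> H H'; apply: trans2; apply: (mulG _ _ H H').
have nonswap t : G1_plane F t -> (lpart t).1.1 = false -> even_isom t.
  case: t => [[[w e1] e2] [a b]] Ht /= Ew; subst w.
  have E := half _ _ _ Ht erefl; subst e2.
  case: e1 Ht => [Ht|]; last exact: trans2.
  have [_ trF] := isoF; split.
    (* Translations being even, none takes warp 0 to warp 1. So [t1] is a half-turn, and
       [- 1 + a1 = 1] gives [a1 = 2]; by [half_diff] every half-turn has the same parity. *)
    have [t1 [Ht1]] := trF (Warp 0) (Warp 1).
    case: t1 Ht1 => [[[[] e1] e2] [a1 b1]] // Ht1.
    have E := half _ _ _ Ht1 erefl; subst e2.
    case: e1 Ht1 => Ht1 /= [Ea1]; last by case: (trans2 _ _ Ht1) => /=; lia.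
    by case: (half_diff _ _ _ _ Ht Ht1) => /=; lia.
  have [t1 [Ht1]] := trF (Weft 0) (Weft 1).
  case: t1 Ht1 => [[[[] e1] e2] [a1 b1]] // Ht1.
  have E := half _ _ _ Ht1 erefl; subst e2.
  case: e1 Ht1 => Ht1 /= [Ea1]; last by case: (trans2 _ _ Ht1) => /=; lia.
  by case: (half_diff _ _ _ _ Ht Ht1) => /=; lia.
have swap e1 e2 a b : G1_plane F (Isom (true, e1, e2) (a, b)) ->
    (2 %| a - a0)%Z /\ (2 %| b - a0)%Z.
  (* The products of [t] with [t0] and of [t0] with itself exchange nothing, so they are even:
     modulo 2, [a = b0], [b = a0] and [a0 = b0]. *)
  move=> Ht; case: (nonswap _ (mulG _ _ Ht G0) erefl) => /=.
  case: (nonswap _ (mulG _ _ G0 G0) erefl) => /=.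
  by case: e1 e2 f1 f2 {Ht G0} => [] [] [] [] /=; lia.
(* Conjugation by [(a0, 0)] changes both components of an exchanging symmetry by [a0] up to sign,
   and those of any other symmetry by even amounts. *)
exists a0 => t'; set u := translation a0 0.
rewrite -[t'](isom_conjK u); set t := isom_conj _ t' => -[r].
move=> /(G1_shift a0 0 F t r) Ht.
have {Ht} Ht : G1_plane F t by exists r.
case: t Ht => [[[[] e1] e2] [a b]] Ht.
  have := swap _ _ _ _ Ht.
  by case: e1 e2 {Ht} => [] [] [] /= ha hb; split=> /=; lia.
have [/= ha hb] := nonswap _ Ht erefl.
by case: e1 e2 {Ht} => [] []; split=> /=; lia.
Qed.

Lemma step1_genus F s :
  roth_class s F -> G1_step s = 1%N -> genus_I F \/ genus_II F.
Proof.
case=> _ _ _ [_ _ [_ [a [[] Hr]] _] _] step1; rewrite step1 in Hr;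
  by [right; exists a | left; exists a].
Qed.

(** * Prefabrics given by a table *)

Definition residue (n : nat) (x : int) : nat := `|(x %% n%:Z)%Z|%N.

(* Bit j of row i is the value at the cell (i, j), for 0 <= i, j < n. *)
Definition table_bit (rows : seq N) (i j : nat) : bool :=
  N.testbit_nat (nth 0%num rows i) j.

Definition weave (n : nat) (rows : seq N) : prefabric :=
  fun i j => table_bit rows (residue n i) (residue n j).

(** This is [flip] followed by a translation, read modulo [n]: [- i - 1] becomes [n.-1 - i], where
    truncated subtraction is exact for [i < n]. *)
Definition move_residue (n : nat) (e : bool) (a i : nat) : nat :=
  (((if e then n.-1 - i else i) + a) %% n)%N.

(* Unlike all, it stops at the first failure under call-by-value. *)
Fixpoint every (T : Type) (p : T -> bool) (l : seq T) : bool :=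
  if l is x :: l' then if p x then every p l' else false else true.

Lemma everyE (T : Type) (p : T -> bool) (l : seq T) : every p l = all p l.
Proof. by elim: l => //= x l ->. Qed.

(** Exchanging warps and wefts turns a warp on top into a weft on top, and so does the reversal by
    tau; the two cancel, hence [w (+) r]. *)
Definition symmetry_mod (n : nat) (rows : seq N)
    (u : d4) (a b : nat) (r : bool) : bool :=
  let: (w, e1, e2) := u in
  every (fun i => every (fun j =>
    table_bit rows (move_residue n e1 a (if w then j else i))
                   (move_residue n e2 b (if w then i else j))
    == table_bit rows i j (+) (w (+) r)) (iota 0 n)) (iota 0 n).

Definition residue_isom : Type := (d4 * (nat * nat))%type.

Definition all_d4 : seq d4 :=
  [seq (we, e) | we <- [seq (w, e) | w <- [:: false; true],
                                     e <- [:: false; true]],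
                 e <- [:: false; true]].

(** The search covers all [8 n^2] candidates, so the list is complete modulo translations by
    multiples of [n]. *)
Definition symmetries (n : nat) (rows : seq N) (r : bool) :
    seq residue_isom :=
  [seq x <- [seq (u, v) | u <- all_d4,
                          v <- [seq (a, b) | a <- iota 0 n, b <- iota 0 n]]
     | symmetry_mod n rows x.1 x.2.1 x.2.2 r].

Definition isom_mod (n : nat) (t : isom) : residue_isom :=
  (lpart t, (residue n (tpart t).1, residue n (tpart t).2)).

Section Residues.

Variable n : nat.
Hypothesis n_gt0 : (0 < n)%N.

Lemma ltn_residue x : (residue n x < n)%N.
Proof.
have n0 : n%:Z != 0 by rewrite eqz_nat -lt0n.
by rewrite /residue; have := modz_ge0 x n0; have := ltz_mod x n0; lia.
Qed.

Lemma residue_divz x : x = (x %/ n%:Z)%Z * n%:Z + (residue n x)%:Z.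
Proof.
have n0 : n%:Z != 0 by rewrite eqz_nat -lt0n.
by rewrite /residue gez0_abs ?modz_ge0 // -divz_eq.
Qed.

Lemma residueMDl q i : (i < n)%N -> residue n (q * n%:Z + i%:Z) = i.
Proof. by move=> lin; rewrite /residue modzMDl modz_nat modn_small. Qed.

Lemma residue_nat (i : nat) : (i < n)%N -> residue n i%:Z = i.
Proof. by move=> lin; rewrite -{1}[i%:Z]add0r -(mul0r n%:Z) residueMDl. Qed.

Lemma residueMDl_mod q i : residue n (q * n%:Z + i%:Z) = (i %% n)%N.
Proof. by rewrite /residue modzMDl modz_nat. Qed.

Lemma residue_move e a x :
  residue n (flip e x + a) = move_residue n e (residue n a) (residue n x).
Proof.
rewrite /move_residue -(residueMDl_mod
  ((if e then - (x %/ n%:Z)%Z - 1 else (x %/ n%:Z)%Z) + (a %/ n%:Z)%Z)).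
congr residue; rewrite {1}[x]residue_divz {1}[a]residue_divz.
have := ltn_residue x; move: (residue n x) (residue n a) => i j lt_i.
case: e => /=; last by rewrite PoszD; ring.
have -> : (n.-1 - i + j)%N%:Z = n%:Z - 1 - i%:Z + j%:Z by lia.
by ring.
Qed.

Lemma residue_eqP x y :
  residue n x = residue n y <-> exists k, x = y + k * n%:Z.
Proof.
split=> [E|[k ->]].
  exists ((x %/ n%:Z)%Z - (y %/ n%:Z)%Z).
  by rewrite {1}[x]residue_divz {1}[y]residue_divz E; ring.
by rewrite [y]residue_divz addrAC -mulrDl !residueMDl ?ltn_residue.
Qed.

End Residues.

Lemma G1E F w e1 e2 a b r :
  G1 F (Isom (w, e1, e2) (a, b)) r <->
  forall i j, F (flip e1 (if w then j else i) + a)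
                (flip e2 (if w then i else j) + b) = F i j (+) (w (+) r).
Proof.
split=> [H i j|H].
  have := H (Warp i) (Weft j) => /= ->.
  by case: w r {H} => [] [] /=; rewrite ?addbF ?addbT ?negbK.
move=> [] i [] j; rewrite /over /=.
- by case: w r {H} => [] [].
- by have := H i j; case: w r {H} => [] [] /= ->;
    rewrite ?addbF ?addbT ?negbK.
- by have := H j i; case: w r {H} => [] [] /= ->;
    rewrite ?addbF ?addbT ?negbK.
- by case: w r {H} => [] [].
Qed.

Section Table.

Variables (n : nat) (rows : seq N).
Hypothesis n_gt0 : (0 < n)%N.
Let F := weave n rows.

(** [F] has period [n] in both directions, so the isometry and the cells to be compared matter only
    modulo [n]. *)
Lemma G1_weave t r : G1 F t r <-> isom_mod n t \in symmetries n rows r.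
Proof.
rewrite mem_filter; case: t => [[[w e1] e2] [a b]].
have -> : isom_mod n (Isom (w, e1, e2) (a, b)) \in
    [seq (u, v) | u <- all_d4,
                  v <- [seq (a, b) | a <- iota 0 n, b <- iota 0 n]].
  apply: allpairs_f; first by case: w e1 e2 => [] [] [].
  by apply: allpairs_f; rewrite mem_iota ltn_residue.
rewrite andbT G1E /symmetry_mod /= everyE; split=> [H|/allP H i j].
  apply/allP => i; rewrite mem_iota => /= lt_i.
  rewrite everyE; apply/allP => j; rewrite mem_iota => /= lt_j; apply/eqP.
  have := H i%:Z j%:Z; rewrite /F /weave !residue_move //.
  by case: w {H}; rewrite !residue_nat.
have Hi : residue n i \in iota 0 n by rewrite mem_iota ltn_residue.
have Hj : residue n j \in iota 0 n by rewrite mem_iota ltn_residue.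
have := H _ Hi; rewrite everyE => /allP /(_ _ Hj) /eqP.
by rewrite /F /weave !residue_move //; case: w {H}.
Qed.

Lemma symmetries_lt x r :
  x \in symmetries n rows r -> (x.2.1 < n)%N && (x.2.2 < n)%N.
Proof.
rewrite mem_filter => /andP[_ /allpairsP[[u v] [_ /= Hv ->]]].
move: Hv => /allpairsP[[a b] [/= Ha Hb ->]] /=.
by move: Ha Hb; rewrite !mem_iota /= => -> ->.
Qed.

Lemma G1_plane_weave t : G1_plane F t <->
  isom_mod n t \in symmetries n rows false ++ symmetries n rows true.
Proof.
rewrite mem_cat; split=> [[r /G1_weave H]|/orP[]/G1_weave H].
- by case: r H => ->; rewrite ?orbT.
- by exists false.
- by exists true.
Qed.

Lemma symmetries_G1 u (a b : nat) (k l : int) :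
  (u, (a, b)) \in symmetries n rows false ++ symmetries n rows true ->
  G1_plane F (Isom u (a%:Z + k * n%:Z, b%:Z + l * n%:Z)).
Proof.
move=> H; apply/G1_plane_weave.
have /andP[lt_a lt_b] : (a < n)%N && (b < n)%N.
  by move: H; rewrite mem_cat => /orP[] /symmetries_lt.
suff -> : isom_mod n (Isom u (a%:Z + k * n%:Z, b%:Z + l * n%:Z)) = (u, (a, b)).
  by [].
by rewrite /isom_mod /= ![_%:Z + _]addrC !residueMDl.
Qed.

Lemma weave_translation p q :
  G1 F (translation (p * n%:Z) (q * n%:Z)) false.
Proof.
apply/G1E => i j; rewrite !addbF /F /weave /flip /=.
by congr table_bit; apply/residue_eqP => //; [exists p | exists q].
Qed.

(** * Order, connectedness and transitivity *)

Definition bit_along (s : bool) (i k : nat) : bool :=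
  if s then table_bit rows k i else table_bit rows i k.

Definition order_check : bool :=
  all (fun s => all (fun i => all (fun m =>
    has (fun k => bit_along s i ((k + m) %% n)%N != bit_along s i k) (iota 0 n))
    (iota 1 n.-1)) (iota 0 n)) [:: false; true].

Lemma order_weave : order_check -> order F n.
Proof.
move=> /allP H s; split.
  split=> // k; case: s => i /=; rewrite /F /weave; congr table_bit;
    by apply/residue_eqP => //; exists 1; rewrite mul1r.
move=> m [m0 Hm]; rewrite leqNgt; apply/negP => lt_mn.
pose b := if s is Weft _ then true else false.
pose i := match s with Warp i | Weft i => i end.
have Hb : b \in [:: false; true] by case: (b).
have Hi : residue n i \in iota 0 n by rewrite mem_iota ltn_residue.
have Hm' : m \in iota 1 n.-1 by rewrite mem_iota m0; lia.
have /hasP[k] := allP (allP (H _ Hb) _ Hi) _ Hm'.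
rewrite mem_iota => /= lt_k /negP[]; apply/eqP.
have Ek : residue n (k%:Z + m%:Z) = ((k + m) %% n)%N.
  by rewrite -(residueMDl_mod n 0) mul0r add0r.
have := Hm k%:Z; rewrite /b /i /bit_along; case: s {Hm b i Hb Hi} => i /=.
  by rewrite /F /weave Ek residue_nat.
by rewrite /F /weave Ek residue_nat.
Qed.

Definition connected_check : bool :=
  all (fun i => all (fun i' => (i == i') ||
    has (fun j => ~~ table_bit rows i j && table_bit rows i' j) (iota 0 n))
    (iota 0 n)) (iota 0 n).

(* If no warp lies over another one everywhere, a set A of strands that lies
   over its complement cannot separate two warps: the weft that passes over
   the first and under the second would be neither in A nor outside it. *)
Lemma connected_weave :
  (1 < n)%N -> order F n -> connected_check -> ~ falls_apart F.
Proof.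
move=> n1 ordF /allP H [A [[s As] [s' As'] HA]].
have in_iota i : residue n i \in iota 0 n by rewrite mem_iota ltn_residue.
(* Membership in [A] is an arbitrary proposition, so only a double negation is obtained; this
   suffices for a contradiction. *)
have sep i i' : residue n i != residue n i' -> A (Warp i) -> ~ ~ A (Warp i').
  move=> ne Ai Ai'; have := allP (H _ (in_iota i)) _ (in_iota i').
  rewrite (negPf ne) /= => /hasP[j]; rewrite mem_iota => /= lt_j.
  move=> /andP[Hi Hi'].
  have Aj : ~ A (Weft j).
    move=> Aj; have := HA _ _ Aj Ai' isT.
    by rewrite /= /F /weave residue_nat ?Hi'.
  by have := HA _ _ Ai Aj isT; rewrite /= /F /weave residue_nat // (negPf Hi).
have warps i i' : A (Warp i) -> ~ ~ A (Warp i').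
  case: (altP (residue n i =P residue n i')) => [E Ai Ai'|]; last exact: sep.
  have ne : residue n i != residue n (i + 1).
    apply/eqP => /residue_eqP -/(_ n_gt0) [k Ek].
    have : (n%:Z %| 1)%Z by apply/dvdzP; exists (- k); rewrite mulNr; lia.
    by rewrite dvdz1 absz_nat; lia.
  (* Warps of equal residue are compared through warp [i + 1], whose residue is different because
     [1 < n]. *)
  apply: (sep _ _ ne Ai) => Ai1.
  by apply: (sep (i + 1) i'); rewrite -?E 1?eq_sym.
(* A weft that is always over or always under would have period 1, against the order [n > 1]. *)
have mixed j b : exists i, F i j = b.
  have [/hasP[i iP /eqP <-]|/hasPn none] :=
    boolP (has (fun i => table_bit rows i (residue n j) == b) (iota 0 n)).
    exists (Posz i); rewrite /F /weave residue_nat //.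
    by rewrite mem_iota in iP.
  suff /(proj2 (ordF (Weft j)) 1%N) : strand_period F (Weft j) 1 by lia.
  have const k : F k j = ~~ b.
    have := none _ (in_iota k); rewrite /F /weave.
    by case: table_bit (b) => [] [].
  by split=> // k; rewrite /= !const.
have weft_out j : ~ A (Weft j) -> exists i, ~ A (Warp i).
  move=> Aj; have [i Fi] := mixed j false; exists i => Ai.
  by have := HA _ _ Ai Aj isT; rewrite /= Fi.
have weft_in j : A (Weft j) -> exists i, ~ ~ A (Warp i).
  move=> Aj; have [i Fi] := mixed j true; exists i => Ai.
  by have := HA _ _ Aj Ai isT; rewrite /= Fi.
have [i Ai] : exists i, ~ ~ A (Warp i).
  by case: s As => [i Ai|j Aj]; [exists i => /(_ Ai) | exact: weft_in Aj].
have [i' Ai'] : exists i, ~ A (Warp i).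
  by case: s' As' => [i' Ai'|j Aj]; [exists i' | exact: weft_out Aj].
by apply: Ai => Ai; exact: (warps i i').
Qed.

Definition transitive_check (syms : seq residue_isom) : bool :=
  all (fun k =>
    has (fun x : residue_isom => let: (w, e1, e2) := x.1 in
      ~~ w && (move_residue n e1 x.2.1 0 == k)) syms
    && has (fun x : residue_isom => let: (w, e1, e2) := x.1 in
      w && (move_residue n e2 x.2.2 0 == k)) syms) (iota 0 n).

(** It is enough that the images of warp 0 exhaust the strands; thanks to the translations by [n],
    only their residues have to be attained. *)
Lemma isonemal_weave :
  transitive_check (symmetries n rows false ++ symmetries n rows true) ->
  isonemal F.
Proof.
move=> /allP H; split.
  exists n%:Z, 0, 0, n%:Z; split; first by rewrite mulr0 subr0 mulf_neq0; lia.
    exists false; have := weave_translation 1 0.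
    by rewrite mul1r mul0r.
  exists false; have := weave_translation 0 1.
  by rewrite mul1r mul0r.
have from0 s : exists2 t, G1_plane F t & isom_strand t (Warp 0) = s.
  pose k := match s with Warp i | Weft i => i end.
  have Hk : residue n k \in iota 0 n by rewrite mem_iota ltn_residue.
  have /andP[/hasP[x Hx Ex] /hasP[y Hy Ey]] := H _ Hk.
  (* A listed symmetry reaches the index only modulo [n]; adding [m] periods makes it exact. *)
  have lift e (a : nat) : move_residue n e a 0 = residue n k -> (a < n)%N ->
      exists m, flip e 0 + (a%:Z + m * n%:Z) = k.
    move=> E lt_a; move: E; rewrite -(residue_nat lt_a) -{1}(residue_nat n_gt0).
    rewrite -residue_move // => /residue_eqP -/(_ n_gt0) [m Em].
    exists (- m); rewrite (residue_nat lt_a) mulNr.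
    by move: Em; case: (e) => /=; lia.
  have lt_syms z : z \in symmetries n rows false ++ symmetries n rows true ->
      (z.2.1 < n)%N && (z.2.2 < n)%N.
    by rewrite mem_cat => /orP[] /symmetries_lt.
  move: s @k lift Ex Ey {H Hk} => [] k /= lift Ex Ey.
    case: x Hx Ex => [[[w e1] e2] [a b]] Hx /andP[/negPf w0 /eqP E]; subst w.
    have /andP[lt_a _] := lt_syms _ Hx; have [m Em] := lift _ _ E lt_a.
    exists (Isom (false, e1, e2) (a%:Z + m * n%:Z, b%:Z + 0 * n%:Z)).
      exact: symmetries_G1.
    exact: (congr1 Warp Em).
  case: y Hy Ey => [[[w e1] e2] [a b]] Hy /andP[w1 /eqP /= E].
  move: w1 Hy => /= -> Hy.
  have /andP[_ lt_b] := lt_syms _ Hy; have [m Em] := lift _ _ E lt_b.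
  exists (Isom (true, e1, e2) (a%:Z + 0 * n%:Z, b%:Z + m * n%:Z)).
    exact: symmetries_G1.
  exact: (congr1 Weft Em).
move=> s s'; have [t [r Ht] Es] := from0 s; have [t' [r' Ht'] Es'] := from0 s'.
exists (isom_mul t' (isom_inv t)); split.
  by exists (r' (+) r); apply: G1_mul => //; apply: G1_inv.
by rewrite isom_strand_mul -Es isom_Kinv.
Qed.

End Table.

(** * Crystallographic types *)

(* The conventional cell: its edges are (c11, c21) and (c12, c22), and its
   origin is (c1 / 2, c2 / 2). *)
Record unit_cell : Type :=
  UnitCell { c11 : int; c12 : int; c21 : int; c22 : int; c1 : int; c2 : int }.

Definition cell_det (c : unit_cell) : int := c11 c * c22 c - c12 c * c21 c.

Definition cell_vec (c : unit_cell) (z : int * int) : int * int :=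
  (c11 c * z.1 + c12 c * z.2, c21 c * z.1 + c22 c * z.2).

(* The vector w is twice an integral combination of the edges of the cell. *)
Definition twice_cell_vec (c : unit_cell) (w : int * int) : bool :=
  (2 * cell_det c %| c22 c * w.1 - c12 c * w.2)%Z &&
  (2 * cell_det c %| c11 c * w.2 - c21 c * w.1)%Z.

(** Cramer's rule: the dividends in [twice_cell_vec] are [cell_det c] times the coordinates of [w]
    along the edges. *)
Lemma twice_cell_vecP c w : cell_det c != 0 -> twice_cell_vec c w ->
  exists m n : int, w = (2 * (cell_vec c (m, n)).1, 2 * (cell_vec c (m, n)).2).
Proof.
move=> nz /andP[/dvdzP[m Em] /dvdzP[n En]]; exists m, n.
case: w Em En => x y /= Em En; congr (_, _); apply: (mulfI nz).
  transitivity (c11 c * (m * (2 * cell_det c))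
                + c12 c * (n * (2 * cell_det c))).
    by rewrite -Em -En /cell_det; ring.
  by ring.
transitivity (c21 c * (m * (2 * cell_det c)) + c22 c * (n * (2 * cell_det c))).
  by rewrite -Em -En /cell_det; ring.
by ring.
Qed.

(* The translation parts of the general positions have coordinates 0 and 1/2;
   the two booleans tell which ones are 1/2. *)
Definition position : Type := (d4 * (bool * bool))%type.

Definition position_of (q : d4 * pt) : position :=
  (q.1, (q.2.1 != 0, q.2.2 != 0)).

Definition intb (b : bool) : int := if b then 1 else 0.

Lemma position_ofE w q : q \in general_positions w ->
  q.2 = ((intb (q.2.1 != 0))%:~R / 2, (intb (q.2.2 != 0))%:~R / 2).
Proof.
have h0 : (2^-1 != 0 :> rat) by rewrite invr_eq0.
by case: w; rewrite /general_positions !inE;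
  do ?[case/orP]; move/eqP=> ->; rewrite ?eqxx ?h0 ?mul0r ?mul1r.
Qed.

(** With C the edge matrix, the first two tests say [u C = C q.1]. The last compares translation
    parts modulo the lattice of the cell, doubled because origins and general positions involve
    halves. *)
Definition matches (c : unit_cell) (u : d4) (v : int * int) (q : position) :=
  if (lin u (c11 c, c21 c) == cell_vec c (lin q.1 (1, 0))) &&
     (lin u (c12 c, c22 c) == cell_vec c (lin q.1 (0, 1)))
  then
      let o := lin u (c1 c, c2 c) in
      let h := cell_vec c (intb q.2.1, intb q.2.2) in
      twice_cell_vec c (o.1 - c1 c + 2 * v.1 - h.1, o.2 - c2 c + 2 * v.2 - h.2)
  else false.

(** The four divisibilities put [(n, 0)] and [(0, n)] in the lattice of the cell, so that matching
    with general positions can be tested on residues. *)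
Definition cell_check (n : nat) (c : unit_cell) (syms : seq residue_isom)
    (w : wallpaper) : bool :=
  let qs := [seq position_of q | q <- general_positions w] in
  let edge x y :=
    ((false, false, false), (residue n x, residue n y)) \in syms in
  [&& cell_det c != 0,
      edge (c11 c) (c21 c), edge (c12 c) (c22 c),
      (cell_det c %| n%:Z * c11 c)%Z, (cell_det c %| n%:Z * c12 c)%Z,
      (cell_det c %| n%:Z * c21 c)%Z, (cell_det c %| n%:Z * c22 c)%Z,
      all (fun x : residue_isom =>
        has (matches c x.1 (x.2.1%:Z, x.2.2%:Z)) qs) syms &
      all (fun q => has (fun x : residue_isom =>
        matches c x.1 (x.2.1%:Z, x.2.2%:Z) q) syms) qs].

(** The passage from plane to cell coordinates, inverse to [cell_pt]; it is the conjugating map of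
    [crystallographic_type]. *)
Definition cell_affine (c : unit_cell) : affine :=
  let d : rat := (cell_det c)%:~R in
  Affine ((c22 c)%:~R / d) (- (c12 c)%:~R / d)
         (- (c21 c)%:~R / d) ((c11 c)%:~R / d)
         (- ((c22 c * c1 c - c12 c * c2 c)%:~R / (2 * d)))
         (- ((c11 c * c2 c - c21 c * c1 c)%:~R / (2 * d))).

Definition cell_pt (c : unit_cell) (y : pt) : pt :=
  ((c11 c)%:~R * y.1 + (c12 c)%:~R * y.2 + (c1 c)%:~R / 2,
   (c21 c)%:~R * y.1 + (c22 c)%:~R * y.2 + (c2 c)%:~R / 2).

Lemma cell_ptK c : cell_det c != 0 ->
  cancel (cell_pt c) (affine_pt (cell_affine c)).
Proof.
rewrite -(intr_eq0 rat) => nz [x y]; have := nz; rewrite /cell_det.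
rewrite /cell_pt /affine_pt /= /cell_det !(intrB, intrM) => nz'.
by congr (_, _); field.
Qed.

Lemma cell_affineK c : cell_det c != 0 ->
  cancel (affine_pt (cell_affine c)) (cell_pt c).
Proof.
rewrite -(intr_eq0 rat) => nz [x y]; have := nz; rewrite /cell_det.
rewrite /cell_pt /affine_pt /= /cell_det !(intrB, intrM) => nz'.
by congr (_, _); field.
Qed.

Lemma cell_affine_invertible c : cell_det c != 0 -> invertible (cell_affine c).
Proof.
rewrite -(intr_eq0 rat) => nz; rewrite /invertible /=.
have -> : (c22 c)%:~R / (cell_det c)%:~R * ((c11 c)%:~R / (cell_det c)%:~R) -
   - (c12 c)%:~R / (cell_det c)%:~R * (- (c21 c)%:~R / (cell_det c)%:~R) =
   (cell_det c)%:~R^-1 :> rat.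
  by move: nz; rewrite /cell_det !(intrB, intrM) => nz; field.
by rewrite invr_eq0.
Qed.

Lemma lin_int u (x y : int) :
  lin u (x, y) = ((lin u (1, 0)).1 * x + (lin u (0, 1)).1 * y,
                  (lin u (1, 0)).2 * x + (lin u (0, 1)).2 * y).
Proof. by case: u => [[[] []] []]; rewrite /lin /=; congr (_, _); lia. Qed.

Lemma lin_rat u (x y : rat) :
  lin u (x, y) =
  (((lin u (1, 0)).1 : int)%:~R * x + ((lin u (0, 1)).1 : int)%:~R * y,
   ((lin u (1, 0)).2 : int)%:~R * x + ((lin u (0, 1)).2 : int)%:~R * y).
Proof. by case: u => [[[] []] []]; rewrite /lin /=; congr (_, _); ring. Qed.

(** One coordinate of [u (C y + o/2) + v = C (Q y + h/2 + k) + o/2], where C is the edge matrix and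
    Q the linear part of a general position. The premises are the same coordinate of [u C = C Q] and
    of the doubled translation condition. *)
Lemma conjugates_coordinate (K : numFieldType)
    (a b p q r s p' q' l l' m m' o o' o1 h h' k k' v y1 y2 : K) :
  a * p + b * r = p' * l + q' * l' ->
  a * q + b * s = p' * m + q' * m' ->
  a * o + b * o' - o1 + 2 * v - (p' * h + q' * h') = 2 * (p' * k + q' * k') ->
  a * (p * y1 + q * y2 + o / 2) + b * (r * y1 + s * y2 + o' / 2) + v =
  p' * (l * y1 + m * y2 + h / 2 + k) + q' * (l' * y1 + m' * y2 + h' / 2 + k')
  + o1 / 2.
Proof.
move=> E1 E2 E3.
transitivity ((a * p + b * r) * y1 + (a * q + b * s) * y2 +
  ((a * o + b * o' - o1 + 2 * v - (p' * h + q' * h'))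
    + o1 + (p' * h + q' * h')) / 2); first by field.
by rewrite E1 E2 E3; field.
Qed.

Lemma cell_conjugates c u v (q : d4 * pt) w (m n : int) :
  cell_det c != 0 -> q \in general_positions w ->
  lin u (c11 c, c21 c) == cell_vec c (lin q.1 (1, 0)) ->
  lin u (c12 c, c22 c) == cell_vec c (lin q.1 (0, 1)) ->
  (let o := lin u (c1 c, c2 c) in
   let h := cell_vec c (intb (q.2.1 != 0), intb (q.2.2 != 0)) in
   (o.1 - c1 c + 2 * v.1 - h.1, o.2 - c2 c + 2 * v.2 - h.2)
   = (2 * (cell_vec c (m, n)).1, 2 * (cell_vec c (m, n)).2)) ->
  conjugates (cell_affine c) (Isom u v)
    (fun z => lin q.1 z + q.2 + (m%:~R, n%:~R)).
Proof.
move=> nz hq /eqP + /eqP + + z.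
have Ez := esym (cell_affineK nz z); rewrite {1}Ez.
move: (affine_pt _ z) => [y1 y2] {z Ez}.
have := position_ofE hq.
move: (intb (q.2.1 != 0)) (intb (q.2.2 != 0)) => h1 h2.
case: q {hq} => q1 q2 /= ->; case: v => v1 v2.
rewrite /cell_vec (lin_int u (c11 c)) (lin_int u (c12 c)) (lin_int u (c1 c)) /=.
move=> -[E11 E21] [E12 E22] [F1 F2].
rewrite -[RHS](cell_ptK nz); congr affine_pt.
move: (congr1 (intr : int -> rat) E11) (congr1 (intr : int -> rat) E12).
move: (congr1 (intr : int -> rat) E21) (congr1 (intr : int -> rat) E22).
move: (congr1 (intr : int -> rat) F1) (congr1 (intr : int -> rat) F2).
rewrite !(intrB, intrD, intrM) => {}F1 {}F2 {}E21 {}E22 {}E11 {}E12.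
rewrite /isom_pt /cell_pt (lin_rat u) (lin_rat q1) /=; congr (_, _).
  exact: conjugates_coordinate E11 E12 F1.
exact: conjugates_coordinate E21 E22 F2.
Qed.

(** Moving [v] by a multiple of [n] in each coordinate adds twice a lattice vector to the vector
    under test; the new quotients come from Cramer's rule. *)
Lemma matches_period n c u v q (k l : int) :
  (cell_det c %| n%:Z * c11 c)%Z -> (cell_det c %| n%:Z * c12 c)%Z ->
  (cell_det c %| n%:Z * c21 c)%Z -> (cell_det c %| n%:Z * c22 c)%Z ->
  matches c u v q -> matches c u (v.1 + k * n%:Z, v.2 + l * n%:Z) q.
Proof.
move=> /dvdzP[x11 E11] /dvdzP[x12 E12] /dvdzP[x21 E21] /dvdzP[x22 E22].
case/andP=> /andP[H1 H2] H; apply/andP; split; first by rewrite H1 H2.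
move: H.
move: (lin u (c1 c, c2 c)) (cell_vec c (intb q.2.1, intb q.2.2)).
move=> [o1 o2] [h1 h2] /andP[/dvdzP[y Ey] /dvdzP[z Ez]].
rewrite /= in Ey Ez *; apply/andP; split; apply/dvdzP.
  exists (y + x22 * k - x12 * l) => /=.
  transitivity (y * (2 * cell_det c) + 2 * k * (x22 * cell_det c)
                - 2 * l * (x12 * cell_det c)); last by ring.
  by rewrite -Ey -E22 -E12; ring.
exists (z + x11 * l - x21 * k) => /=.
transitivity (z * (2 * cell_det c) + 2 * l * (x11 * cell_det c)
              - 2 * k * (x21 * cell_det c)); last by ring.
by rewrite -Ez -E11 -E21; ring.
Qed.

Section CellCheck.

Variables (n : nat) (c : unit_cell) (syms : seq residue_isom) (w : wallpaper).
Variable G : isom -> Prop.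
Hypothesis n_gt0 : (0 < n)%N.
Hypothesis G_mod : forall t, G t <-> isom_mod n t \in syms.
Hypothesis G_mul : forall t t', G t -> G t' -> G (isom_mul t t').
Hypothesis G_inv : forall t, G t -> G (isom_inv t).
Hypothesis syms_lt : forall x, x \in syms -> (x.2.1 < n)%N && (x.2.2 < n)%N.

Lemma translation_multiple x y (k : int) :
  G (translation x y) -> G (translation (k * x) (k * y)).
Proof.
move=> Gxy.
have step a b : G (translation a b) -> G (translation (a + x) (b + y)).
  by move=> Gab; apply: (G_mul Gxy Gab).
have stepN a b : G (translation a b) -> G (translation (a - x) (b - y)).
  by move=> Gab; apply: (G_mul (G_inv Gxy) Gab).
have G0 : G (translation 0 0) by have := stepN _ _ Gxy; rewrite !subrr.
elim/int_rec: k => [|k IH|k IH]; first by rewrite !mul0r.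
  by rewrite -addn1 PoszD !mulrDl !mul1r; apply: step.
by rewrite -addn1 PoszD opprD !mulrDl !mulN1r; apply: stepN.
Qed.

(** Each symmetry is reduced modulo [n], matched, and lifted by [matches_period]. Conversely, a
    matched residue realises a general position up to a lattice vector, which translations along the
    edges supply. *)
Lemma cell_check_type : cell_check n c syms w -> crystallographic_type G w.
Proof.
case/and5P=> nz edge1 edge2 d11.
case/and5P=> d12 d21 d22 /allP Hsyms /allP Hqs.
have G1e : G (translation (c11 c) (c21 c)) by apply/G_mod.
have G2e : G (translation (c12 c) (c22 c)) by apply/G_mod.
exists (cell_affine c); split; first exact: cell_affine_invertible.
  case=> u [a b] /G_mod/Hsyms /hasP[_ /mapP[q hq ->]] /= Hm.
  have := matches_period (a %/ n%:Z)%Z (b %/ n%:Z)%Z d11 d12 d21 d22 Hm.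
  rewrite /= ![_%:Z + _]addrC -!residue_divz // => {}Hm.
  have /andP[/andP[E1 E2] /(twice_cell_vecP nz) [m [k E]]] := Hm.
  exists (fun z => lin q.1 z + q.2 + (m%:~R, k%:~R)).
    by exists q => //; exists m, k.
  exact: cell_conjugates nz hq E1 E2 E.
move=> g [q hq [m [k Eg]]].
have /Hqs /hasP[[u [a b]] Hx /= Hm] := map_f position_of hq.
have /andP[/andP[E1 E2] /(twice_cell_vecP nz) [m0 [k0 E0]]] := Hm.
have Gt0 : G (Isom u (a%:Z, b%:Z)).
  apply/G_mod; have /andP[/= lt_a lt_b] := syms_lt Hx.
  by rewrite /isom_mod /= !residue_nat.
(* The listed symmetry has lattice part [(m0, k0)]; edge translations move it to the required
   [(m, k)]. *)
pose v := (a%:Z + (m - m0) * c11 c + (k - k0) * c12 c,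
           b%:Z + (m - m0) * c21 c + (k - k0) * c22 c).
exists (Isom u v).
  have := G_mul (translation_multiple (k - k0) G2e)
            (G_mul (translation_multiple (m - m0) G1e) Gt0).
  by case: (u) => [[s e1] e2].
move=> z; rewrite Eg; apply: (cell_conjugates nz hq E1 E2).
move: E0 => /=; move: (lin u (c1 c, c2 c)) (intb _) (intb _) => o h1 h2.
rewrite /cell_vec /= => -[F1 F2]; congr (_, _).
  transitivity (2 * (c11 c * m0 + c12 c * k0) +
                2 * ((m - m0) * c11 c + (k - k0) * c12 c)); last by ring.
  by rewrite -F1; ring.
transitivity (2 * (c21 c * m0 + c22 c * k0) +
              2 * ((m - m0) * c21 c + (k - k0) * c22 c)); last by ring.
by rewrite -F2; ring.
Qed.

End CellCheck.

(** * Certificates *)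

Definition step_check (n : nat) (syms : seq residue_isom) (d : nat) : bool :=
  [&& (0 < d)%N, (d %| n)%N,
      has (fun x : residue_isom =>
        (x.1 == (false, false, false)) && (x.2.2 == d %% n)%N) syms &
      all (fun x : residue_isom =>
        (x.1 == (false, false, false)) ==> (d %| x.2.2)%N) syms].

(** As [d] divides [n], divisibility of a vertical component by [d] can be read from its residue. *)
Lemma step_check_row (n d : nat) syms (G : isom -> Prop) : (0 < n)%N ->
  (forall t, G t <-> isom_mod n t \in syms) ->
  (forall x, x \in syms -> (x.2.1 < n)%N && (x.2.2 < n)%N) ->
  step_check n syms d -> row_step G d.
Proof.
move=> n0 G_mod syms_lt /and4P[d0 dvd_n /hasP[[u [a b]] Hx Hab] /allP Hall].
move: Hab => /andP[/eqP /= Eu /eqP Eb]; split=> //.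
  exists a%:Z; apply/G_mod; have /andP[/= lt_a _] := syms_lt _ Hx.
  by rewrite /isom_mod /= residue_nat // -[d%:Z]add0r -(mul0r n%:Z)
    residueMDl_mod -Eb -Eu.
move=> x k /G_mod /Hall /= dvd_k.
by rewrite (residue_divz n0 k) rpredD // dvdz_mull.
Qed.

Record certificate : Type := Certificate {
  order_of : nat;
  table : seq N;
  G1_cell : unit_cell;
  H1_cell : unit_cell
}.

Definition certified (c : certificate) (s : roth_type) : bool :=
  let n := order_of c in
  let side := symmetries n (table c) false in
  let reverse := symmetries n (table c) true in
  let plane := side ++ reverse in
  [&& [&& (4 < n)%N, order_check n (table c), connected_check n (table c)
        & transitive_check n plane],
      cell_check n (G1_cell c) plane (G1_type s),
      match H1_type s with
      | None => nilp reverse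
      | Some w => cell_check n (H1_cell c) side w && ~~ nilp reverse
      end,
      step_check n plane (G1_step s) & step_check n side (H1_step s)].

Lemma certified_roth_class c s :
  certified c s -> roth_class s (weave (order_of c) (table c)).
Proof.
case/and5P=> /and4P[n4 ordF conF isoF] cG1 cH1 stepG1 stepH1.
have n0 : (0 < order_of c)%N by apply: leq_trans n4.
have {}ordF := order_weave n0 ordF.
have plane_lt x : x \in symmetries (order_of c) (table c) false
    ++ symmetries (order_of c) (table c) true ->
    (x.2.1 < order_of c)%N && (x.2.2 < order_of c)%N.
  by rewrite mem_cat => /orP[] /symmetries_lt.
split.
- exact: isonemal_weave.
- by exists (order_of c).
- by apply: connected_weave conF => //; apply: leq_trans n4.
- have G1P := G1_plane_weave (table c) n0.
  have H1P t := G1_weave (table c) n0 t false.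
  split.
  + apply: (cell_check_type n0 G1P) cG1 => //.
    * by move=> t t' [r Hr] [r' Hr']; exists (r (+) r'); apply: G1_mul.
    * by move=> t [r Hr]; exists r; apply: G1_inv.
  + case: (H1_type s) cH1 => [w /andP[cH1 rev]|/nilP rev t [] //].
      split.
        apply: (cell_check_type n0 H1P) cH1 => //.
        * by move=> t t'; apply: (@G1_mul _ t t' false false).
        * by move=> t; apply: G1_inv.
        * by move=> x; apply: symmetries_lt.
      case E: (symmetries _ _ true) rev => [//|[u [a b]] l] _.
      have Hx : (u, (a, b)) \in symmetries (order_of c) (table c) true.
        by rewrite E mem_head.
      exists (Isom u (a%:Z, b%:Z)); apply/G1_weave => //.
      have /andP[/= lt_a lt_b] := symmetries_lt Hx.
      by rewrite /isom_mod /= !residue_nat.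
    by move=> /(G1_weave (table c) n0); rewrite rev.
  + exact: step_check_row stepG1.
  + apply: step_check_row stepH1 => // x; exact: symmetries_lt.
Qed.

(* In the order of roth_types; the second cell is not used when H1 = G1. *)
Definition certificates : seq certificate := [::
  Certificate 12 [:: 0x939; 0x732; 0x64e; 0x9cc; 0x993; 0x273; 0xe64; 0xc9c;
    0x399; 0x327; 0x4e6; 0xcc9]%num
    (UnitCell 3 2 3 (-2) 1 1) (UnitCell 3 2 3 (-2) 1 1);
  Certificate 20 [:: 0x9c486; 0x90d38; 0xa7121; 0x2434e; 0x69c48; 0x890d3;
    0x1a712; 0xe2434; 0x869c4; 0x3890d; 0x21a71; 0x4e243; 0x4869c; 0xd3890;
    0x121a7; 0x34e24; 0xc4869; 0xd389; 0x7121a; 0x434e2]%num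
    (UnitCell 2 5 (-2) 5 0 1) (UnitCell (-2) 5 2 5 0 0);
  Certificate 24 [:: 0xb114ee; 0x8a7758; 0x3bac45; 0xd6229d; 0x114eeb;
    0xa77588; 0xbac453; 0x6229dd; 0x14eeb1; 0x77588a; 0xac453b; 0x229dd6;
    0x4eeb11; 0x7588a7; 0xc453ba; 0x29dd62; 0xeeb114; 0x588a77; 0x453bac;
    0x9dd622; 0xeb114e; 0x88a775; 0x53bac4; 0xdd6229]%num
    (UnitCell 2 3 2 (-3) 2 1) (UnitCell 4 3 4 (-3) 4 3);
  Certificate 12 [:: 0x709; 0x47b; 0x5c2; 0xd1e; 0x970; 0xb47; 0x25c; 0xed1;
    0x97; 0x7b4; 0xc25; 0x1ed]%num
    (UnitCell 1 6 (-1) 6 0 0) (UnitCell 2 6 (-2) 6 2 0);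
  Certificate 8 [:: 0xa1; 0xd0; 0x68; 0x34; 0x1a; 0xd; 0x86; 0x43]%num
    (UnitCell 1 4 (-1) 4 0 0) (UnitCell (-1) 4 1 4 0 0);
  Certificate 12 [:: 0xdc8; 0x46e; 0x723; 0x1b9; 0xc8d; 0x6e4; 0x237; 0xb91;
    0x8dc; 0xe46; 0x372; 0x91b]%num
    (UnitCell 3 1 (-3) 1 2 0) (UnitCell 3 2 (-3) 2 2 0);
  Certificate 8 [:: 0x8c; 0xb9; 0x23; 0x6e; 0xc8; 0x9b; 0x32; 0xe6]%num
    (UnitCell 4 1 4 (-1) 3 3) (UnitCell 4 2 4 (-2) 3 3);
  Certificate 8 [:: 0x61; 0xb; 0x58; 0xc2; 0x16; 0xb0; 0x85; 0x2c]%num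
    (UnitCell 4 2 4 (-2) 2 2) (UnitCell (-2) 1 2 3 0 0);
  Certificate 14 [:: 0x3d84; 0x3b09; 0x3613; 0x2c27; 0x184f; 0x309e; 0x213d;
    0x27b; 0x4f6; 0x9ec; 0x13d8; 0x27b0; 0xf61; 0x1ec2]%num
    (UnitCell 1 7 1 (-7) 0 0) (UnitCell 1 7 1 (-7) 1 0);
  Certificate 8 [:: 0xdc; 0x64; 0x73; 0x91; 0xcd; 0x46; 0x37; 0x19]%num
    (UnitCell 4 2 (-4) 2 0 0) (UnitCell 4 2 (-4) 2 4 0);
  Certificate 12 [:: 0x8f1; 0xe31; 0x63c; 0x78c; 0x18f; 0x1e3; 0xc63; 0xc78;
    0xf18; 0x31e; 0x3c6; 0x8c7]%num
    (UnitCell 2 3 (-2) 3 1 0) (UnitCell 2 3 (-2) 3 1 0);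
  Certificate 8 [:: 0x8d; 0x6c; 0x36; 0xb1; 0xd8; 0xc6; 0x63; 0x1b]%num
    (UnitCell 4 2 (-4) 2 4 0) (UnitCell 4 2 (-4) 2 4 0);
  Certificate 12 [:: 0x96c; 0x64b; 0x5b2; 0x92d; 0x6c9; 0x4b6; 0xb25; 0x2d9;
    0xc96; 0xb64; 0x25b; 0xd92]%num
    (UnitCell 3 2 (-3) 2 4 1) (UnitCell 3 2 (-3) 2 0 0);
  Certificate 12 [:: 0x25c; 0xf16; 0x970; 0xc5b; 0x5c2; 0x16f; 0x709; 0x5bc;
    0xc25; 0x6f1; 0x97; 0xbc5]%num
    (UnitCell 6 2 (-6) 2 4 0) (UnitCell 6 2 (-6) 2 0 2);
  Certificate 12 [:: 0x7e9; 0x4bf; 0xfa5; 0x2fd; 0xe97; 0xbf4; 0xa5f; 0xfd2;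
    0x97e; 0xf4b; 0x5fa; 0xd2f]%num
    (UnitCell 3 2 (-3) 2 4 1) (UnitCell 2 (-3) 2 3 4 1);
  Certificate 12 [:: 0xc12; 0xd2; 0xb04; 0x834; 0x2c1; 0x20d; 0x4b0; 0x483;
    0x12c; 0xd20; 0x4b; 0x348]%num
    (UnitCell 2 6 (-2) 6 4 4) (UnitCell (-2) 6 2 6 4 4);
  Certificate 6 [:: 0x26; 0x13; 0x29; 0x34; 0x1a; 0xd]%num
    (UnitCell 1 3 (-1) 3 1 0) (UnitCell 3 1 3 (-1) 1 0);
  Certificate 8 [:: 0x6c; 0xc9; 0xb1; 0x27; 0xc6; 0x9c; 0x1b; 0x72]%num
    (UnitCell 2 4 2 (-4) 2 0) (UnitCell 4 2 (-4) 2 2 0);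
  Certificate 6 [:: 0x3c; 0x39; 0x33; 0x27; 0xf; 0x1e]%num
    (UnitCell 1 3 1 (-3) 0 1) (UnitCell 1 (-3) 1 3 0 1);
  Certificate 8 [:: 0xb; 0x34; 0x2c; 0xd0; 0xb0; 0x43; 0xc2; 0xd]%num
    (UnitCell 2 4 2 (-4) 4 0) (UnitCell 2 (-4) 2 4 4 0);
  Certificate 8 [:: 0xb4; 0x69; 0xd2; 0xa5; 0x4b; 0x96; 0x2d; 0x5a]%num
    (UnitCell 1 2 1 (-2) 0 1) (UnitCell 4 1 (-4) 1 0 1);
  Certificate 8 [:: 0x72; 0x1b; 0xc9; 0x6c; 0x27; 0xb1; 0x9c; 0xc6]%num
    (UnitCell 4 1 (-4) 1 0 2) (UnitCell 4 2 (-4) 2 1 3);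
  Certificate 16 [:: 0x47b8; 0x21de; 0x11ee; 0x8877; 0x847b; 0xe21d; 0xe11e;
    0x7887; 0xb847; 0xde21; 0xee11; 0x7788; 0x7b84; 0x1de2; 0x1ee1;
    0x8778]%num
    (UnitCell 2 4 (-2) 4 4 2) (UnitCell 2 8 (-2) 8 8 6);
  Certificate 8 [:: 0x53; 0xac; 0xb2; 0x4d; 0x35; 0xca; 0x2b; 0xd4]%num
    (UnitCell 4 2 (-4) 2 0 2) (UnitCell 4 4 (-4) 4 2 4);
  Certificate 6 [:: 0x3a; 0x35; 0x2b; 0x17; 0x2e; 0x1d]%num
    (UnitCell 3 1 (-3) 1 0 2) (UnitCell 1 (-3) 1 3 0 2);
  Certificate 8 [:: 0x8c; 0x4c; 0x32; 0x31; 0xc8; 0xc4; 0x23; 0x13]%num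
    (UnitCell 4 2 (-4) 2 4 0) (UnitCell 2 (-4) 2 4 4 0);
  Certificate 8 [:: 0xa; 0x50; 0x82; 0x14; 0xa0; 0x5; 0x28; 0x41]%num
    (UnitCell 2 4 (-2) 4 2 0) (UnitCell (-2) 1 2 3 2 0);
  Certificate 16 [:: 0x9e8d; 0x9b17; 0x367a; 0x5e6c; 0xe8d9; 0xb179; 0x67a3;
    0xe6c5; 0x8d9e; 0x179b; 0x7a36; 0x6c5e; 0xd9e8; 0x79b1; 0xa367;
    0xc5e6]%num
    (UnitCell 8 4 (-8) 4 0 2) (UnitCell 4 (-2) 4 6 0 2);
  Certificate 6 [:: 0x1c; 0x38; 0x31; 0x23; 0x7; 0xe]%num
    (UnitCell 3 1 (-3) 1 0 0) (UnitCell 3 1 (-3) 1 0 0);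
  Certificate 8 [:: 0x93; 0x63; 0xe4; 0xd8; 0x39; 0x36; 0x4e; 0x8d]%num
    (UnitCell 2 4 (-2) 4 1 1) (UnitCell 2 4 (-2) 4 1 1);
  Certificate 12 [:: 0x276; 0x46e; 0x9d8; 0x1b9; 0x762; 0x6e4; 0xd89; 0xb91;
    0x627; 0xe46; 0x89d; 0x91b]%num
    (UnitCell 6 2 (-6) 2 6 0) (UnitCell 6 2 (-6) 2 6 0);
  Certificate 16 [:: 0xa7f2; 0x54fe; 0x3560; 0x6ac; 0x7f2a; 0x4fe5; 0x5603;
    0x6ac0; 0xf2a7; 0xfe54; 0x6035; 0xac06; 0x2a7f; 0xe54f; 0x356; 0xc06a]%num
    (UnitCell 8 4 (-8) 4 6 0) (UnitCell 8 4 (-8) 4 6 0);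
  Certificate 10 [:: 0xe5; 0x29c; 0x253; 0x1ca; 0x139; 0xa7; 0x394; 0x272;
    0x14e; 0x329]%num
    (UnitCell 3 (-1) 1 3 2 0) (UnitCell 3 (-1) 1 3 2 0);
  Certificate 10 [:: 0x236; 0x1b1; 0x368; 0x316; 0x28d; 0x16c; 0xda; 0x2c5;
    0x1a3; 0x5b]%num
    (UnitCell 2 (-4) 4 2 2 0) (UnitCell 2 (-4) 4 2 2 0);
  Certificate 5 [:: 0x17; 0x1e; 0x1b; 0xf; 0x1d]%num
    (UnitCell 1 (-2) 2 1 0 0) (UnitCell 1 2 2 (-1) 0 0);
  Certificate 10 [:: 0x13b; 0x1cb; 0x3b4; 0xb7; 0x34e; 0x372; 0xed; 0x32d;
    0x2d3; 0x2dc]%num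
    (UnitCell 2 (-4) 4 2 2 2) (UnitCell 2 4 4 (-2) 2 2);
  Certificate 10 [:: 0x2e8; 0x345; 0x22e; 0x174; 0x3a2; 0x117; 0xba; 0x1d1;
    0x28b; 0x5d]%num
    (UnitCell 2 (-1) 1 2 0 0) (UnitCell 1 (-3) 3 1 0 0);
  Certificate 20 [:: 0x941af; 0x5829f; 0xbe506; 0x7d60a; 0x1af94; 0x29f58;
    0x506be; 0x60a7d; 0xf941a; 0xf5829; 0x6be50; 0xa7d60; 0x41af9; 0x829f5;
    0xe506b; 0xd60a7; 0xaf941; 0x9f582; 0x6be5; 0xa7d6]%num
    (UnitCell 2 (-4) 4 2 2 4) (UnitCell 6 (-2) 2 6 8 6);
  Certificate 20 [:: 0xc5d3c; 0xa33cb; 0x8b0ce; 0x30d17; 0x3cc5d; 0xcba33;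
    0xce8b0; 0x1730d; 0x5d3cc; 0x33cba; 0xb0ce8; 0xd173; 0xcc5d3; 0xba33c;
    0xe8b0c; 0x730d1; 0xd3cc5; 0x3cba3; 0xce8b; 0xd1730]%num
    (UnitCell 2 (-6) 6 2 6 4) (UnitCell 8 (-4) 4 8 2 12)].

Lemma certificates_certified :
  all (fun x => certified x.1 x.2) (zip certificates roth_types).
Proof. by vm_compute. Qed.

(** * Inhabitants of all classes and the two colouring claims *)

Lemma roth_class_inhabited s : List.In s roth_types -> exists F, roth_class s F.
Proof.
(* Equality of sizes is required because [zip] truncates the longer list. *)
suff H (l : seq certificate) (l' : seq roth_type) : size l = size l' ->
    all (fun x => certified x.1 x.2) (zip l l') -> List.In s l' ->
    exists F, roth_class s F by exact: H certificates_certified.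
elim: l l' => [|c l IH] [|s' l'] //= [El] /andP[Hc Hl] [<-|]; last exact: IH.
by exists (weave (order_of c) (table c)); apply: certified_roth_class.
Qed.

Lemma roth_types_step s :
  List.In s roth_types -> G1_step s = 1%N \/ G1_step s = 2%N.
Proof. by rewrite /=; do 39![case=> [<-|]; first by [left | right]]. Qed.

Theorem theorem1 (K : prefabric -> Prop) (hK : species K) :
  (exists F : prefabric, K F /\
     exists (C : Type) (c : strand -> C), thin_all_distinct c /\ perfect F c)
  /\
  (~ (forall F : prefabric, K F -> genus_I F \/ genus_II F) ->
   exists F : prefabric, K F /\
     exists (C : Type) (c : strand -> C), thick_all_distinct c /\ perfect F c).
Proof.
(* Both constructors yield a nonempty part of one Roth class, closed under shifts; the rest of the
   argument relies on this alone. *)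
have [s [Hs K_class [F0 KF0] K_shift]] : exists s, [/\ List.In s roth_types,
    forall F, K F -> roth_class s F, exists F, K F
    & forall p q F, K F -> K (shift p q F)].
  case: K / hK => [s Hs | s K Hs KC K0 K_closed].
    exists s; split=> //; first exact: roth_class_inhabited.
    by move=> p q F; apply: roth_class_shift.
  exists s; split=> // p q F KF; apply: (K_closed (translation p q) F) => //.
    exact/roth_class_shift/KC.
  exact: same_symmetry_group_shift.
split=> [|not_genus].
  exists F0; split=> //; exists strand, id; split=> //; exact: strand_perfect.
(* Row step 1 would place every fabric of [K] in genus I or II, so row step 2 remains. *)
have [step1|step2] := roth_types_step Hs.
  by case: not_genus => F /K_class HF; apply: step1_genus HF step1.
have [p even_p] := genus_free_even (K_class _ KF0) step2.
exists (shift p 0 F0); split; first exact: K_shift.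
by exists strand, pair_of; split=> //; apply: even_isom_thick.
Qed.
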